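(* The NGEV equilibrium assignment is equivalent to each of the following fixed-point problems. [FP-A] Find $\mathbf x^*\in X\cap Y$ such that $\mathbf x^*=\mathbf F(\mathbf C(\mathbf x^* ))$. [FP-C] Find $\mathbf c^*\in\mathcal C$ such that $\mathbf c^*=\mathbf C(\mathbf F(\mathbf c^* ))$.
   Context: Network. $G=(\mathcal N,\mathcal L)$ is a finite directed time-space network; $\mathcal L=\mathcal L_T\cup\mathcal L_A\cup\mathcal L_B\cup\mathcal L_Q$ is partitioned into time-space (driving), access/egress/transfer, on-board and boarding-queue links. $\Psi$ is the set of run-station pairs $(r,s)$, and $\mathcal L_Q$ is the disjoint union of sets $\mathcal L_Q^{(r,s)}$, $(r,s)\in\Psi$, each consisting of links numbered $l=1,\dots,N$. For each $(r,s)$ there is a sequence of on-board nodes $1,\dots,N$; the $l$-th boarding-queue link (flow $z_l^{(r,s)}$) enters the $l$-th on-board node, the $l$-th on-board link (flow $x_l^{(r,s)}$) leaves it, and $x_0^{(r,s)}$ is the flow on the link of run $r$ entering the first on-board node; flow conservation gives $x_l^{(r,s)}=x_{l-1}^{(r,s)}+z_l^{(r,s)}=x_0^{(r,s)}+\sum_{k=1}^l z_k^{(r,s)}$. Costs. The vector link cost function $\mathbf C$ maps aggregated link flows $\mathbf x\in\mathbb R_+^{|\mathcal L|}$ to link costs as follows. The cost of each link $ij\in\mathcal L_T\cup\mathcal L_A\cup\mathcal L_B$ is a continuous, differentiable, strictly increasing function of its own flow $x_{ij}$. On-board links of run $r$ have capacity $\mu^{(r)}$, and the cost of the $l$-th boarding-queue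 link of $(r,s)$ is $f_l\big(x_0^{(r,s)}+\sum_{k=1}^l z_k^{(r,s)}\mid\mu^{(r)}\big)$, where $f_l(\cdot\mid\mu)$ is continuous, differentiable and strictly increasing with $\lim_{x\to\mu}f_l(x\mid\mu)=+\infty$ (value $+\infty$ for $x\ge\mu$). Costs are nonnegative. $Y$ (supply-feasible flows) is the set of $\mathbf x\in\mathbb R_+^{|\mathcal L|}$ with $\mathbf C(\mathbf x)$ finite; $\mathcal C=\{\mathbf C(\mathbf x):\mathbf x\in Y\}$. Demand. $\mathcal D$ is the set of destinations; $\mathbf q_d=(q_i^d)_{i\in\mathcal N}$ is the given demand to $d$, with $q_i^d>0$ when $(i,d)$ is an origin-destination pair and $q_i^d=0$ otherwise. $\mathcal F(i)$ and $\mathcal B(i)$ are the sets of successor and predecessor nodes of $i$. $X_d$ is the set of $\mathbf x_d=(x^d_{ij})_{ij\in\mathcal L}\ge\mathbf 0$ with $\sum_{n\in\mathcal F(i)}x_{in}^d-\sum_{n\in\mathcal B(i)}x_{ni}^d=q_i^d$ for all $i\in\mathcal N\setminus\{d\}$. $\hat X=\prod_{d\in\mathcal D}X_d$, with elements $\hat{\mathbf x}=(\mathbf x_d)_{d\in\mathcal D}$; $X=\{\sum_d\mathbf x_d:\hat{\mathbf x}\in\hat X\}$. NGEV equilibrium assignment. Parameters: $\theta_i^d>0$ and $\alpha_{ji}^d\ge0$ with $\sum_{i\in\mathcal B(j)}\alpha_{ji}^d=1$. The problem is to find link costs $\mathbf c=(c_{ij})$, flows $\hat{\mathbf x}\in\hat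 X$ with $\mathbf x=\sum_d\mathbf x_d\in X\cap Y$, and expected minimum costs $(s_{id})_{i\in\mathcal N,d\in\mathcal D}$ (with $s_{dd}=0$) such that $\mathbf c=\mathbf C(\mathbf x)$ and, for all $d\in\mathcal D$, all $i\in\mathcal N\setminus\{d\}$ and all links $ij$, $$p^d_{ij|i}=\frac{\alpha^d_{ji}e^{-\theta^d_i(c_{ij}+s_{jd})}}{\sum_{n\in\mathcal F(i)}\alpha^d_{ni}e^{-\theta^d_i(c_{in}+s_{nd})}},\quad 1=\sum_{n\in\mathcal F(i)}\alpha^d_{ni}e^{-\theta^d_i(c_{in}+s_{nd}-s_{id})},\quad x^d_{ij}=p^d_{ij|i}\sum_{n\in\mathcal F(i)}x^d_{in}.$$ Demand function. With the convention $0\ln0=0$, $$H_d(\mathbf x_d)=-\sum_{i\in\mathcal N}\frac1{\theta_i^d}\sum_{j\in\mathcal F(i)}x_{ij}^d\Big[\ln\frac{x_{ij}^d}{\sum_{n\in\mathcal F(i)}x_{in}^d}-\ln\alpha_{ji}^d\Big];$$ for $\mathbf c\in\mathcal C$, $\mathbf F_d(\mathbf c)$ is the unique minimizer of $\mathbf c\cdot\mathbf x_d-H_d(\mathbf x_d)$ over $\mathbf x_d\in X_d$, and $\mathbf F(\mathbf c)=\sum_{d\in\mathcal D}\mathbf F_d(\mathbf c)$. Equivalence means that $\mathbf x^*$ (resp. $\mathbf c^*$) is the aggregated flow (resp. cost) component of a solution of the NGEV equilibrium assignment if and only if it solves [FP-A] (resp. [FP-C]).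
   Formalization: The time-space network is taken to be acyclic; at nodes from which d cannot be reached through links with positive α, s_{id} is set to +∞ (no flow, choice probabilities 0) instead of requiring the normalization equation, which no value can satisfy at a sink other than d. *)

(* Defs.v *)
From mathcomp Require Import all_boot all_order all_algebra.
From mathcomp Require Import all_classical all_reals all_analysis.

Set Implicit Arguments.
Unset Strict Implicit.
Unset Printing Implicit Defensive.

Import Order.TTheory GRing.Theory Num.Theory numFieldNormedType.Exports.

Local Open Scope classical_set_scope.
Local Open Scope ring_scope.

(* L_T, L_A (access/egress/transfer), L_B, L_Q; a class may be empty. *)
Variant link_class := TimeSpace | Access | OnBoard | Queue.

(* Links are an abstract finite type with endpoints, so that a sum over
   n \in F(i) (resp. B(i)) is a sum over the links with source (resp. target) i.
   The 1-based index l = 1..N of queue links and on-board nodes becomes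
   l : 'I_N (0-based), whereas [vlink rs k], k = 0..N, carries the flow x_k:
   vlink rs 0 is the link of the run entering the first on-board node and
   vlink rs k, k >= 1, is the k-th on-board link. *)
Record network := Network {
  node : finType;
  link : finType;
  run : finType;
  station : finType;
  src : link -> node;
  tgt : link -> node;
  simple_network : injective (fun e => (src e, tgt e));
  (* Time-space network: there is no directed cycle. *)
  acyclic_network : forall p : seq node,
    cycle (fun i j => [exists e, (src e == i) && (tgt e == j)]) p -> p = [::];
  class_of : link -> link_class;
  run_stations : {set run * station};
  board_size : nat;
  qlink : run * station -> 'I_board_size -> link;
  onode : run * station -> 'I_board_size -> node;
  vlink : run * station -> 'I_board_size.+1 -> link;
  queue_linksP : forall e, class_of e = Queue <->
    exists2 rs, rs \in run_stations & exists l, e = qlink rs l;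
  qlink_inj : {in run_stations &, forall rs rs' l l',
    qlink rs l = qlink rs' l' -> (rs, l) = (rs', l')};
  vlink0_class : {in run_stations, forall rs,
    class_of (vlink rs ord0) <> Queue};
  vlinkS_class : {in run_stations, forall rs (l : 'I_board_size),
    class_of (vlink rs (lift ord0 l)) = OnBoard};
  onode_in : {in run_stations, forall rs (l : 'I_board_size) e,
    tgt e = onode rs l <->
    e = qlink rs l \/ e = vlink rs (widen_ord (leqnSn _) l)};
  onode_out : {in run_stations, forall rs (l : 'I_board_size) e,
    src e = onode rs l <-> e = vlink rs (lift ord0 l)} }.

(* Differentiability of f on D, relative to D: one-sided at an end point of D. *)
Definition differentiable_on (R : realType) (D : set R) (f : R -> R) :=
  forall x, D x ->
    cvg ((fun y => (y - x)^-1 * (f y - f x)) @ within D (dnbhs x)).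

Definition regular_cost (R : realType) (D : set R) (f : R -> R) :=
  [/\ {within D, continuous f}, differentiable_on D f &
      forall x y, D x -> D y -> x < y -> f x < f y].

Record costs (R : realType) (G : network) := Costs {
  link_cost : link G -> R -> R;
  capacity : run G -> R;
  (* queue_cost l mu x is f_l(x | mu) *)
  queue_cost : 'I_(board_size G) -> R -> R -> \bar R;
  link_cost_ge0 : forall e x, class_of e <> Queue -> 0 <= x ->
    0 <= link_cost e x;
  link_cost_regular : forall e, class_of e <> Queue ->
    regular_cost `[0, +oo[ (link_cost e);
  capacity_gt0 : forall r, 0 < capacity r;
  queue_cost_ge0 : forall l mu x, 0 < mu -> 0 <= x ->
    (0 <= queue_cost l mu x)%E;
  queue_cost_fin : forall l mu x, 0 < mu -> 0 <= x -> x < mu ->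
    queue_cost l mu x \is a fin_num;
  queue_cost_regular : forall l mu, 0 < mu ->
    regular_cost `[0, mu[ (fun x => fine (queue_cost l mu x));
  queue_cost_lim : forall l mu, 0 < mu ->
    queue_cost l mu x @[x --> mu^'-] --> +oo%E;
  queue_cost_pinfty : forall l mu x, 0 < mu -> mu <= x ->
    queue_cost l mu x = +oo%E }.

Record demand (R : realType) (G : network) := Demand {
  dests : {set node G};
  od_pairs : {set node G * node G};
  (* trips i d is q_i^d *)
  trips : node G -> node G -> R;
  trips_gt0 : forall i d, d \in dests -> (i, d) \in od_pairs ->
    0 < trips i d;
  trips_eq0 : forall i d, d \in dests -> (i, d) \notin od_pairs ->
    trips i d = 0 }.

(* theta i d is theta_i^d; for a link e = ij, alpha e d is alpha_{ji}^d.
   The normalization is required at nodes having a predecessor, since the sum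
   is empty at the others. *)
Record ngev_params (R : realType) (G : network) (Q : demand R G) := NGEVParams {
  theta : node G -> node G -> R;
  alpha : link G -> node G -> R;
  theta_gt0 : forall i d, d \in dests Q -> 0 < theta i d;
  alpha_ge0 : forall e d, d \in dests Q -> 0 <= alpha e d;
  alpha_sum1 : forall j d, d \in dests Q -> (exists e, tgt e = j) ->
    \sum_(e : link G | tgt e == j) alpha e d = 1 }.

Definition link_costs (R : realType) (G : network) (K : costs R G)
    (x : link G -> R) (e : link G) : \bar R :=
  if [pick k : (run G * station G) * 'I_(board_size G)
      | (k.1 \in run_stations G) && (qlink k.1 k.2 == e)] is Some k then
    let: (rs, l) := k in
    queue_cost K l (capacity K rs.1)
      (x (vlink rs ord0) +
       \sum_(m < board_size G | (m <= l)%N) x (qlink rs m))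
  else (link_cost K e (x e))%:E.

Definition supply_feasible (R : realType) (G : network) (K : costs R G) :
    set (link G -> R) :=
  [set x | (forall e, 0 <= x e) /\ forall e, link_costs K x e \is a fin_num].

(* Finite cost vectors are handled as real vectors. *)
Definition attainable_costs (R : realType) (G : network) (K : costs R G) :
    set (link G -> R) :=
  [set c | exists2 x, supply_feasible K x &
           forall e, link_costs K x e = (c e)%:E].

Definition dest_feasible (R : realType) (G : network) (Q : demand R G)
    (d : node G) : set (link G -> R) :=
  [set x | (forall e, 0 <= x e) /\
    forall i, i != d ->
      \sum_(e : link G | src e == i) x e - \sum_(e : link G | tgt e == i) x e
      = trips Q i d].

(* A family (x_d)_{d in dests} is a function of all nodes d, of which only the
   values at destinations are ever used. *)
Definition aggregate (R : realType) (G : network) (Q : demand R G)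
    (xh : node G -> link G -> R) : link G -> R :=
  fun e => \sum_(d in dests Q) xh d e.

Definition hat_feasible (R : realType) (G : network) (Q : demand R G) :
    set (node G -> link G -> R) :=
  [set xh | forall d, d \in dests Q -> dest_feasible Q d (xh d)].

Definition demand_feasible (R : realType) (G : network) (Q : demand R G) :
    set (link G -> R) :=
  [set aggregate Q xh | xh in hat_feasible Q].

Definition outflow (R : realType) (G : network) (x : link G -> R) (i : node G) :=
  \sum_(e : link G | src e == i) x e.

(* Since 0 * -oo = 0 and lne 0 = -oo in \bar R, a link with no flow contributes
   0 (convention 0 ln 0 = 0), also when alpha = 0 or when the whole outflow
   vanishes (0 / 0 = 0); a positive flow on a link with alpha = 0 makes the
   value -oo. *)
Definition entropy (R : realType) (G : network) (Q : demand R G)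
    (P : ngev_params Q) (d : node G) (x : link G -> R) : \bar R :=
  (- \sum_(i : node G) ((theta P i d)^-1)%:E *
      \sum_(e : link G | src e == i)
        ((x e)%:E * (lne (x e / outflow x i)%:E - lne (alpha P e d)%:E)))%E.

Definition fd_objective (R : realType) (G : network) (Q : demand R G)
    (P : ngev_params Q) (c : link G -> R) (d : node G) (x : link G -> R) :
    \bar R :=
  ((\sum_(e : link G) c e * x e)%:E - entropy P d x)%E.

(* As usual for extended-real-valued objectives, a minimizer has a finite
   value: if the objective is identically +oo there is none. *)
Definition is_minimizer (R : realType) (G : network) (Q : demand R G)
    (P : ngev_params Q) (c : link G -> R) (d : node G) : set (link G -> R) :=
  [set x | [/\ dest_feasible Q d x,
     fd_objective P c d x \is a fin_num &
     forall y, dest_feasible Q d y ->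
       (fd_objective P c d x <= fd_objective P c d y)%E]].

Definition dest_demand (R : realType) (G : network) (Q : demand R G)
    (P : ngev_params Q) (c : link G -> R) (d : node G) : link G -> R :=
  xget (fun=> 0) (is_minimizer P c d).

(* F_d(c) is meaningful for every destination d; otherwise (e.g. when an origin
   is not connected to its destination) dest_demand is a dummy value. *)
Definition demand_defined (R : realType) (G : network) (Q : demand R G)
    (P : ngev_params Q) (c : link G -> R) :=
  forall d, d \in dests Q -> exists! x, is_minimizer P c d x.

Definition demand_fun (R : realType) (G : network) (Q : demand R G)
    (P : ngev_params Q) (c : link G -> R) : link G -> R :=
  aggregate Q (dest_demand P c).

(* exp (- theta t) for t in ]-oo, +oo], with exp (-oo) = 0 *)
Definition expm (R : realType) (th : R) (t : \bar R) : R :=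
  fine (expeR (- (th%:E * t))).

Definition connected_to (R : realType) (G : network) (Q : demand R G)
    (P : ngev_params Q) (d : node G) (i : node G) : bool :=
  connect (fun j k => [exists e : link G,
    [&& src e == j, tgt e == k & 0 < alpha P e d]]) i d.

(* s i d is s_{id} *)
Definition choice_weight (R : realType) (G : network) (Q : demand R G)
    (P : ngev_params Q) (c : link G -> R) (s : node G -> node G -> \bar R)
    (d : node G) (e : link G) : R :=
  alpha P e d * expm (theta P (src e) d) ((c e)%:E + s (tgt e) d)%E.

(* p^d_{ij|i}; it is 0 (= 0 / 0) at a node i not connected to d. *)
Definition choice_prob (R : realType) (G : network) (Q : demand R G)
    (P : ngev_params Q) (c : link G -> R) (s : node G -> node G -> \bar R)
    (d : node G) (e : link G) : R :=
  choice_weight P c s d e /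
  \sum_(e' : link G | src e' == src e) choice_weight P c s d e'.

(* The minimum cost to d is +oo at the nodes from which d cannot be reached
   through links with alpha > 0, e.g. the nodes later in time than d; at all
   other nodes it is finite. *)
Definition expected_min_cost (R : realType) (G : network) (Q : demand R G)
    (P : ngev_params Q) (c : link G -> R) (s : node G -> node G -> \bar R)
    (d : node G) :=
  [/\ s d d = 0%E,
      forall i, i != d -> ~~ connected_to P d i -> s i d = +oo%E &
      forall i, i != d -> connected_to P d i ->
        s i d \is a fin_num /\
        1 = \sum_(e : link G | src e == i)
              alpha P e d *
              expm (theta P i d) ((c e)%:E + s (tgt e) d - s i d)%E].

Definition is_ngev_equilibrium (R : realType) (G : network) (K : costs R G)
    (Q : demand R G) (P : ngev_params Q) (c : link G -> R)
    (xh : node G -> link G -> R) (s : node G -> node G -> \bar R) :=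
  [/\ hat_feasible Q xh,
      (demand_feasible Q `&` supply_feasible K) (aggregate Q xh),
      forall e, link_costs K (aggregate Q xh) e = (c e)%:E,
      forall d, d \in dests Q -> expected_min_cost P c s d &
      forall d, d \in dests Q -> forall e, src e != d ->
        xh d e = choice_prob P c s d e * outflow (xh d) (src e)].

Definition FP_A (R : realType) (G : network) (K : costs R G)
    (Q : demand R G) (P : ngev_params Q) (x : link G -> R) :=
  let c := fun e => fine (link_costs K x e) in
  [/\ (demand_feasible Q `&` supply_feasible K) x,
      demand_defined P c & x = demand_fun P c].

Definition FP_C (R : realType) (G : network) (K : costs R G)
    (Q : demand R G) (P : ngev_params Q) (c : link G -> R) :=
  [/\ attainable_costs K c, demand_defined P c &
      forall e, (c e)%:E = link_costs K (demand_fun P c) e].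

(* Main.v *)
Require Import Defs.
From mathcomp Require Import all_boot all_order all_algebra.
From mathcomp Require Import all_classical all_reals all_analysis.
From mathcomp Require Import ring lra.

(** Both fixed-point problems follow from one fact: for fixed link costs [c]
and a fixed destination [d], the program defining [F_d(c)] and the NGEV
conditions select the same flow ([minimizerP]). Given this, an equilibrium is
a cost vector [c] that is the cost of the aggregate of the [F_d(c)], and
reading that condition on flows or on costs gives [FP_A] or [FP_C].

The fact is an exact formula for the objective. Let [s] be the expected
minimum costs. At a node connected to [d] the choice probability of a link
[e = ij] is [p_e = alpha_e exp(-theta_i (c_e + s_j - s_i))], so
  [c_e = (ln alpha_e - ln p_e) / theta_i + s_i - s_j].
Multiplying by the flow and summing, the terms [s_i - s_j] telescope by flow
conservation, and for every feasible [x] that uses only links with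
[alpha > 0],
  [c . x - H_d(x) = \sum_i s_i q_i + \sum_i KL_i(x) / theta_i],
where [KL_i(x) = \sum_e x_e (ln (x_e / X_i) - ln p_e)] over the links [e]
leaving [i], with outflow [X_i] ([fd_objectiveE]). By Gibbs' inequality
[KL_i(x) >= 0], with equality iff [x_e = p_e X_i] on these links. The first
sum does not depend on [x], so the flows meeting the NGEV conditions are
exactly the minimizers, provided that such a flow, here called a loading,
exists ([loading_exists]); otherwise the minimum could be larger than the
constant. Uniqueness of the minimizer comes from that of the loading
([loading_unique]), without appeal to strict convexity.

Acyclicity is what makes this work. Expected minimum costs are defined by
recursion on the successors of a node, and the loading by recursion on its
predecessors. It also forces every positive flow to end at [d]
([positive_flow_connect]), so no flow leaves [d] and none uses a node from
which [d] cannot be reached, where the expected minimum cost is [+oo]: the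
infinite values never meet a positive flow. *)

Set Implicit Arguments.
Unset Strict Implicit.
Unset Printing Implicit Defensive.

Import Order.TTheory GRing.Theory Num.Theory.

Local Open Scope ring_scope.

(** * Recursion along the links of an acyclic network *)

(** Well-founded recursion along a rank, phrased as the existence of a solution
of a system of equations in which each unknown depends on those of smaller
rank only. *)
Lemma rank_fixpoint (T A : Type) (r : T -> nat) (a0 : A)
    (F : (T -> A) -> T -> A) :
  (forall f g i, (forall j, (r j < r i)%N -> f j = g j) -> F f i = F g i) ->
  exists f, forall i, f i = F f i.
Proof.
move=> FE; pose it n := iter n F (fun=> a0).
have it_stable n m i : (r i < n)%N -> (r i < m)%N -> it n i = it m i.
  elim: n m i => [//|n IHn] [//|m] i rin rim /=.
  by apply: FE => j rji; apply: IHn; exact: leq_trans rji _.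
(* The value at [i] is final as soon as [F] was applied [r i + 1] times. *)
exists (fun i => it (r i).+1 i) => i; rewrite [LHS]/=.
by apply: FE => j rji; exact: (it_stable (r i) (r j).+1).
Qed.

Section Acyclicity.
Variable G : network.

Definition link_rel (i j : node G) : bool :=
  [exists e : link G, (src e == i) && (tgt e == j)].

Lemma link_relE (e : link G) : link_rel (src e) (tgt e).
Proof. by apply/existsP; exists e; rewrite !eqxx. Qed.

Lemma no_return (e : link G) : ~~ connect link_rel (tgt e) (src e).
Proof.
apply/negP => /connectP[p tp lastp].
suff /acyclic_network : cycle link_rel (tgt e :: p) by [].
by rewrite /= rcons_path tp -lastp link_relE.
Qed.

(** A rank that decreases along links: the source of a link is reachable from
itself, but by acyclicity not from the target of the link. *)
Definition reach_card (i : node G) : nat := #|connect link_rel i|.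

Lemma reach_card_lt (e : link G) : (reach_card (tgt e) < reach_card (src e))%N.
Proof.
apply/proper_card/properP; split.
  apply/fintype.subsetP => k; rewrite !inE; apply: connect_trans.
  exact/connect1/link_relE.
by exists (src e); rewrite !inE ?connect0 //; exact: no_return.
Qed.

End Acyclicity.

(** * Flows to a destination *)

Section Flows.
Variables (R : realType) (G : network) (Q : demand R G) (d : node G).
Hypothesis dD : d \in dests Q.

Lemma trips_ge0 (i : node G) : 0 <= trips Q i d.
Proof.
have [iod|iod] := boolP ((i, d) \in od_pairs Q); first exact/ltW/trips_gt0.
by rewrite trips_eq0.
Qed.

Variable x : link G -> R.
Hypothesis xF : dest_feasible Q d x.

Let x_ge0 e : 0 <= x e. Proof. by case: xF. Qed.

Lemma outflow_ge0 i : 0 <= outflow x i.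
Proof. exact: sumr_ge0. Qed.

Lemma outflow0_link e : outflow x (src e) = 0 -> x e = 0.
Proof.
by move=> /eqP; rewrite psumr_eq0// => /allP/(_ e (mem_index_enum _));
   rewrite eqxx => /eqP.
Qed.

Lemma outflow_balance i : i != d ->
  outflow x i = trips Q i d + \sum_(e : link G | tgt e == i) x e.
Proof. by case: xF => _ bal /bal <-; rewrite subrK. Qed.

Lemma outflow_gt0_link i : 0 < outflow x i -> exists2 e, src e = i & 0 < x e.
Proof.
move=> /gt_eqF/negbT; rewrite psumr_neq0// => /hasP[e _ /andP[/eqP ei xe]].
by exists e.
Qed.

(** A node other than [d] that receives flow also sends flow, since demands are
nonnegative; in an acyclic network following the flow can only end at [d].
Applied to all links this excludes flow out of [d]; applied to the links with
[alpha > 0] it shows that flow stays among the nodes connected to [d]. *)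
Lemma positive_flow_connect (r : rel (node G)) :
  (forall e, 0 < x e -> r (src e) (tgt e)) ->
  forall e, 0 < x e -> connect r (tgt e) d.
Proof.
move=> xr e; have [n] := ubnP (reach_card (tgt e)).
elim: n => // n IHn in e * => le_n xe.
have [->//|td] := eqVneq (tgt e) d.
have [|e' e'E xe'] := @outflow_gt0_link (tgt e).
  rewrite outflow_balance// ltr_wpDl ?trips_ge0//.
  by rewrite (bigD1 e)//= ltr_pwDl// sumr_ge0.
rewrite -e'E; apply: connect_trans (connect1 (xr _ xe')) (IHn _ _ xe').
by apply: leq_trans (reach_card_lt e') _; rewrite e'E.
Qed.

(** Flow conservation is not imposed at [d]; flow leaving [d] is excluded since
it would have to come back to [d]. *)
Lemma dest_link_flow0 e : src e = d -> x e = 0.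
Proof.
move=> ed; apply/eqP; case: (ltgtP (x e) 0) (x_ge0 e) => // xe _.
have /negP[] := no_return e; rewrite ed.
by apply: positive_flow_connect xe => e' _; exact: link_relE.
Qed.

Lemma dest_outflow0 : outflow x d = 0.
Proof. by apply: big1 => e /eqP; exact: dest_link_flow0. Qed.

(** Summation by parts: a potential that vanishes at [d] sees only the demands,
whatever the feasible flow. *)
Lemma potential_flow (V : node G -> R) : V d = 0 ->
  \sum_(e : link G) (V (src e) - V (tgt e)) * x e =
  \sum_(i | i != d) V i * trips Q i d.
Proof.
move=> Vd.
have H (h : link G -> node G) : \sum_(e : link G) V (h e) * x e =
    \sum_(i | i != d) V i * \sum_(e : link G | h e == i) x e.
  rewrite (partition_big h xpredT)//= (bigD1 d)//= big1 ?add0r; last first.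
    by move=> e /eqP ->; rewrite Vd mul0r.
  apply: eq_bigr => i _; rewrite mulr_sumr.
  by apply: eq_bigr => e /eqP ->.
under eq_bigr do rewrite mulrBl.
rewrite sumrB !H -sumrB; apply: eq_bigr => i id.
by rewrite -mulrBr; congr (_ * _); case: xF => _ ->.
Qed.

End Flows.

(** * Gibbs' inequality *)

(** The inequality is stated for weights [y] of arbitrary total [Y]. The
normalization of [p] is required in the form [(\sum p) * Y = Y], so that
nodes without flow are covered whether or not [p] sums to 1 there. *)
Section Gibbs.
Variables (R : realType) (I : finType) (A : pred I) (y p : I -> R).
Hypotheses (y_ge0 : forall e, A e -> 0 <= y e)
  (p_ge0 : forall e, A e -> 0 <= p e)
  (p_gt0 : forall e, A e -> 0 < y e -> 0 < p e).
Let Y := \sum_(e | A e) y e.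
Hypothesis p_sum : (\sum_(e | A e) p e) * Y = Y.

(** The terms of the divergence need not be nonnegative one by one; adding
[p e * Y - y e], which sums to 0, makes them so, by [ln t <= t - 1] at
[t = p e * Y / y e]. *)
Let gap e := y e * (ln (y e / Y) - ln (p e)) - (y e - p e * Y).

Let Y_gt0 e : A e -> 0 < y e -> 0 < Y.
Proof.
by move=> Ae ye; rewrite /Y (bigD1 e)//= ltr_pwDl// sumr_ge0// => i /andP[/y_ge0].
Qed.

Let gap_ge0 e : A e -> 0 <= gap e /\ (gap e = 0 -> y e = p e * Y).
Proof.
move=> Ae; have Y0 : 0 <= Y by exact: sumr_ge0.
rewrite /gap; have := y_ge0 Ae; rewrite le_eqVlt => /orP[/eqP<-|ye].
  by rewrite mul0r !sub0r opprK; split=> //; rewrite mulr_ge0// p_ge0.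
have Yp := Y_gt0 Ae ye; have pe := p_gt0 Ae ye.
set t := p e * Y / y e.
have t0 : 0 < t by rewrite divr_gt0// mulr_gt0.
have -> : ln (y e / Y) - ln (p e) = - ln t.
  rewrite /t !ln_div ?lnM ?posrE ?mulr_gt0//; lra.
have -> : p e * Y = t * y e by rewrite /t divfK// gt_eqF.
have -> : y e * - ln t - (y e - t * y e) = y e * (t - 1 - ln t) by ring.
have lnt : t != 1 -> ln t < t - 1.
  move=> t1; rewrite -ltr_expR lnK ?posrE//.
  by rewrite -[ltLHS](subrKC 1) expR_gt1Dx// subr_eq0.
have [->|/lnt tlt] := eqVneq t 1; first by rewrite ln1 !subrr mulr0 mul1r.
have pos : 0 < y e * (t - 1 - ln t) by rewrite mulr_gt0// subr_gt0.
by split=> [|/eqP]; [exact: ltW | rewrite gt_eqF].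
Qed.

Let divergenceE : \sum_(e | A e) y e * (ln (y e / Y) - ln (p e)) =
  \sum_(e | A e) gap e.
Proof.
by rewrite /gap !sumrB -mulr_suml p_sum subrr subr0.
Qed.

Lemma gibbs_ge0 : 0 <= \sum_(e | A e) y e * (ln (y e / Y) - ln (p e)).
Proof. by rewrite divergenceE sumr_ge0// => e /gap_ge0[]. Qed.

Lemma gibbs_eq0P :
  \sum_(e | A e) y e * (ln (y e / Y) - ln (p e)) = 0 <->
  forall e, A e -> y e = p e * Y.
Proof.
split=> [|yE].
  rewrite divergenceE => /eqP; rewrite psumr_eq0; last by move=> e /gap_ge0[].
  move=> /allP h e Ae; have [_] := gap_ge0 Ae; apply.
  by have := h e (mem_index_enum _); rewrite Ae => /eqP.
apply: big1 => e Ae; have := y_ge0 Ae; rewrite le_eqVlt => /orP[/eqP<-|ye].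
  by rewrite mul0r.
by rewrite {2}(yE _ Ae) mulfK ?gt_eqF ?(Y_gt0 Ae)// subrr mulr0.
Qed.

End Gibbs.
(** * The exponential weights *)

Section Expm.
Variables (R : realType) (th : R).
Hypothesis th_gt0 : 0 < th.

Lemma expmy : expm th +oo%E = 0.
Proof. by rewrite /expm gt0_muley ?lte_fin. Qed.

Lemma expm_fin (v : R) : expm th v%:E = expR (- (th * v)).
Proof. by []. Qed.

Lemma expm_ge0 (t : \bar R) : 0 <= expm th t.
Proof. exact/fine_ge0/expeR_ge0. Qed.

(** Holds for all extended [t]: both sides vanish when [t] is infinite, at
[-oo] because [fine +oo = 0]. *)
Lemma expmB (t : \bar R) (v : R) :
  expm th (t - v%:E)%E = expm th t * expR (th * v).
Proof.
case: t => [t||].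
- by rewrite -EFinB !expm_fin -expRD; congr expR; ring.
- by rewrite addye// expmy mul0r.
- by rewrite addNye /expm gt0_muleNy ?lte_fin//= mul0r.
Qed.

End Expm.

(** * The objective as an extended real number *)

(** A term of [- H_d] is never [-oo], and it is [+oo] exactly when a link
with [alpha = 0] carries flow. Hence the objective is a real number or [+oo]
according to whether the flow is supported by the links with [alpha > 0]. *)
Section Objective.
Variables (R : realType) (G : network) (Q : demand R G) (P : ngev_params Q).
Variables (c : link G -> R) (d : node G) (x : link G -> R).
Hypotheses (dD : d \in dests Q) (xF : dest_feasible Q d x).

Let term e : \bar R := ((x e)%:E *
  (lne (x e / outflow x (src e))%:E - lne (alpha P e d)%:E))%E.

Let share_gt0 e : 0 < x e -> 0 < x e / outflow x (src e).
Proof.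
move=> xe; rewrite divr_gt0// lt0r (outflow_ge0 xF) andbT.
by apply: contraTneq xe => /(outflow0_link xF) ->; rewrite ltxx.
Qed.

Let term_fin e : (0 < x e -> 0 < alpha P e d) -> term e =
  (x e * (ln (x e / outflow x (src e)) - ln (alpha P e d)))%:E.
Proof.
case: xF => x0 _ ae; have := x0 e; rewrite le_eqVlt => /orP[/eqP x0e|xe].
  by rewrite /term -x0e mul0e mul0r.
by rewrite /term !lne_EFin ?share_gt0 ?ae.
Qed.

Let term_pinfty e : 0 < x e -> alpha P e d = 0 -> term e = +oo%E.
Proof.
move=> xe ae; rewrite /term ae (lne_EFin (share_gt0 xe)) le0_lneNy//.
by rewrite addey// gt0_muley ?lte_fin.
Qed.

Let term_gtNy e : term e != -oo%E.
Proof.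
have [xe|xe] := boolP ((0 < x e) ==> (0 < alpha P e d)).
  by rewrite term_fin//; exact/implyP.
move: xe; rewrite negb_imply => /andP[xe ae]; rewrite term_pinfty//.
by apply/eqP; rewrite eq_le alpha_ge0// andbT leNgt.
Qed.

Let fd_objective_termE : fd_objective P c d x =
  ((\sum_e c e * x e)%:E + \sum_i ((theta P i d)^-1)%:E *
     \sum_(e : link G | src e == i) term e)%E.
Proof.
rewrite /fd_objective /entropy oppeK; congr (_ + _)%E.
apply: eq_bigr => i _; congr (_ * _)%E.
by apply: eq_bigr => e /eqP <-.
Qed.

Lemma fd_objective_fin : (forall e, 0 < x e -> 0 < alpha P e d) ->
  fd_objective P c d x =
  (\sum_e c e * x e + \sum_i (theta P i d)^-1 *
     \sum_(e : link G | src e == i)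
        x e * (ln (x e / outflow x i) - ln (alpha P e d)))%:E.
Proof.
move=> xa; rewrite fd_objective_termE EFinD; congr (_ + _)%E.
rewrite -sumEFin; apply: eq_bigr => i _; rewrite EFinM; congr (_ * _)%E.
by rewrite -sumEFin; apply: eq_bigr => e /eqP ei; rewrite term_fin ?ei//; exact: xa.
Qed.

Lemma fd_objective_pinfty e : 0 < x e -> alpha P e d = 0 ->
  fd_objective P c d x = +oo%E.
Proof.
move=> xe ae; rewrite fd_objective_termE.
have ith i : (0 < ((theta P i d)^-1)%:E :> \bar R)%E.
  by rewrite lte_fin invr_gt0 theta_gt0.
have innerNy i : (\sum_(e : link G | src e == i) term e)%E != -oo%E.
  by rewrite esum_eqNy negb_exists; apply/forallP => e'; rewrite negb_and term_gtNy orbT.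
suff -> : (\sum_i ((theta P i d)^-1)%:E *
     \sum_(e : link G | src e == i) term e)%E = +oo%E by rewrite addey.
apply/eqP; rewrite esum_eqy; last first.
  by move=> i _; case: (\sum_(_ | _) _)%E (innerNy i) => // _; rewrite gt0_muley.
apply/existsP; exists (src e) => /=.
suff -> : (\sum_(e' : link G | src e' == src e) term e')%E = +oo%E.
  by rewrite gt0_muley.
apply/eqP; rewrite esum_eqy//; apply/existsP; exists e; apply/andP; split.
  exact: eqxx.
by rewrite term_pinfty.
Qed.

Lemma fd_objective_fin_num :
  fd_objective P c d x \is a fin_num -> forall e, 0 < x e -> 0 < alpha P e d.
Proof.
move=> fin e xe; rewrite lt0r alpha_ge0// andbT.
by apply: contraTneq fin => ae; rewrite (fd_objective_pinfty xe ae).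
Qed.

End Objective.

(** * The NGEV choice probabilities *)

Section Choice.
Variables (R : realType) (G : network) (Q : demand R G) (P : ngev_params Q).
Variables (c : link G -> R) (d : node G).
Hypothesis dD : d \in dests Q.

Lemma connected_link (e : link G) : 0 < alpha P e d ->
  connected_to P d (tgt e) -> connected_to P d (src e).
Proof.
move=> ae; apply: connect_trans; apply: connect1.
by apply/existsP; exists e; rewrite !eqxx.
Qed.

Lemma connected_next (i : node G) : i != d -> connected_to P d i ->
  exists e, [/\ src e = i, 0 < alpha P e d & connected_to P d (tgt e)].
Proof.
move=> id /connectP[[|j p] /=]; first by move=> _ di; rewrite di eqxx in id.
move=> /andP[/existsP[e /and3P[/eqP ei /eqP ej ae]] jp] dE.
by exists e; split=> //; apply/connectP; exists p; rewrite ej.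
Qed.

(** The normalization equation determines the cost of a node from those of its
successors, as a log-sum-exp, so it is solved by recursion; the sum is
positive since a node connected to [d] has a link with [alpha > 0] to another
such node. *)
Lemma expected_min_cost_exists :
  exists f : node G -> \bar R, expected_min_cost P c (fun i _ => f i) d.
Proof.
pose S (f : node G -> \bar R) i := \sum_(e : link G | src e == i)
  alpha P e d * expm (theta P i d) ((c e)%:E + f (tgt e))%E.
pose F (f : node G -> \bar R) i : \bar R :=
  if i == d then 0%E else if connected_to P d i
  then (- ((theta P i d)^-1 * ln (S f i)))%:E else +oo%E.
have [f fE] : exists f, forall i, f i = F f i.
  apply: (rank_fixpoint (r := @reach_card G) 0%E) => f g i fg.
  rewrite /F /S; case: ifP => // _; case: ifP => // _; congr (- (_ * ln _))%:E.
  by apply: eq_bigr => e /eqP ei; rewrite fg// -ei reach_card_lt.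
exists f; split=> [|i id ic|i id ic].
- by rewrite fE /F eqxx.
- by rewrite fE /F (negbTE id) (negbTE ic).
have fi : f i = (- ((theta P i d)^-1 * ln (S f i)))%:E.
  by rewrite fE /F (negbTE id) ic.
split; first by rewrite fi.
have th0 := theta_gt0 P i dD.
have S_gt0 : 0 < S f i.
  have [e [ei ae ec]] := connected_next id ic.
  rewrite /S (bigD1 e) ?ei//= ltr_pwDl//; last first.
    by apply: sumr_ge0 => e' _; rewrite mulr_ge0 ?alpha_ge0 ?expm_ge0.
  have [v ->] : exists v : R, f (tgt e) = v%:E.
    by rewrite fE /F ec; case: eqP => _; eexists.
  by rewrite -EFinD expm_fin mulr_gt0 ?expR_gt0.
under eq_bigr do rewrite fi expmB// mulrA.
rewrite -mulr_suml mulrN mulVKf ?gt_eqF// expRN lnK ?posrE//.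
by rewrite mulfV ?gt_eqF.
Qed.

Variable s : node G -> node G -> \bar R.
Hypothesis sP : expected_min_cost P c s d.

Local Notation p := (choice_prob P c s d).
Local Notation V := (fun i => fine (s i d)).

Lemma min_cost_fin i : connected_to P d i -> s i d = (V i)%:E.
Proof.
case: sP => sd _ sfin ic; have [->|id] := eqVneq i d; first by rewrite sd.
by rewrite fineK//; case: (sfin _ id ic).
Qed.

Lemma min_cost_pinfty i : ~~ connected_to P d i -> s i d = +oo%E.
Proof.
case: sP => _ sinf _ ic; apply: sinf => //.
by apply: contraNneq ic => ->; exact: connect0.
Qed.

Lemma choice_weight_ge0 e : 0 <= choice_weight P c s d e.
Proof. by rewrite mulr_ge0 ?alpha_ge0 ?expm_ge0. Qed.

Lemma choice_prob_ge0 e : 0 <= p e.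
Proof.
by rewrite divr_ge0 ?choice_weight_ge0// sumr_ge0// => *; exact: choice_weight_ge0.
Qed.

Lemma choice_prob_alpha0 e : alpha P e d = 0 -> p e = 0.
Proof. by move=> a0; rewrite /choice_prob /choice_weight a0 !mul0r. Qed.

Lemma choice_prob_unconnected e : ~~ connected_to P d (tgt e) -> p e = 0.
Proof.
move=> ec; rewrite /choice_prob /choice_weight min_cost_pinfty// addey//.
by rewrite expmy ?theta_gt0// mulr0 mul0r.
Qed.

(** By normalization, the denominator of the choice probability at [i] is
[exp (- theta_i * s_i)]. *)
Lemma choice_probE e : src e != d -> connected_to P d (src e) ->
  p e = alpha P e d *
        expm (theta P (src e) d) ((c e)%:E + s (tgt e) d - s (src e) d)%E.
Proof.
move=> ed ec; have [_ _ /(_ _ ed ec)[_ sum1]] := sP.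
have th0 := theta_gt0 P (src e) dD.
rewrite (min_cost_fin ec) in sum1 *.
rewrite expmB// mulrA /choice_prob -/(choice_weight P c s d e).
congr (_ * _).
have W : 1 = (\sum_(e' : link G | src e' == src e) choice_weight P c s d e') *
   expR (theta P (src e) d * V (src e)).
  rewrite sum1 mulr_suml; apply: eq_bigr => e' /eqP e'e.
  by rewrite expmB// mulrA -{1}e'e.
have W0 : \sum_(e' : link G | src e' == src e) choice_weight P c s d e' != 0.
  by apply: contra_eq_neq W => ->; rewrite mul0r oner_neq0.
by rewrite -[LHS]mulr1 W mulKf.
Qed.

Lemma choice_prob_sum1 i : i != d -> connected_to P d i ->
  \sum_(e : link G | src e == i) p e = 1.
Proof.
move=> id ic; have [_ _ /(_ _ id ic)[_ ->]] := sP.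
by apply: eq_bigr => e /eqP ei; rewrite -ei choice_probE ?ei.
Qed.

(** The logit formula solved for the link cost: up to the difference of the
potential [s] along the link, the cost is a difference of logarithms. *)
Lemma choice_prob_ln e : src e != d -> 0 < alpha P e d ->
  connected_to P d (tgt e) ->
  0 < p e /\ c e =
    (theta P (src e) d)^-1 * (ln (alpha P e d) - ln (p e)) +
    (V (src e) - V (tgt e)).
Proof.
move=> ed ae ec; have sc := connected_link ae ec.
rewrite choice_probE// (min_cost_fin ec) (min_cost_fin sc) -EFinD expm_fin.
rewrite mulr_gt0 ?expR_gt0//; split=> //.
rewrite lnM ?posrE ?expR_gt0// expRK.
have th0 := theta_gt0 P (src e) dD.
by field; rewrite gt_eqF.
Qed.

End Choice.
(** * Demand function and NGEV loading *)

Section Loading.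
Variables (R : realType) (G : network) (Q : demand R G) (P : ngev_params Q).
Variables (c : link G -> R) (d : node G) (s : node G -> node G -> \bar R).
Hypotheses (dD : d \in dests Q) (sP : expected_min_cost P c s d).

Local Notation p := (choice_prob P c s d).
Local Notation V := (fun i => fine (s i d)).

(** The flow conditions that an NGEV equilibrium imposes for one destination
once the link costs are fixed. *)
Definition is_loading (x : link G -> R) : Prop :=
  dest_feasible Q d x /\
  forall e, src e != d -> x e = p e * outflow x (src e).

Definition expected_total_cost : R :=
  \sum_(i | i != d) fine (s i d) * trips Q i d.

(** Kullback-Leibler divergence of the shares of [x] from the choice
probabilities, weighted at each node by outflow over [theta]. *)
Definition divergence (x : link G -> R) : R :=
  \sum_i (theta P i d)^-1 * \sum_(e : link G | src e == i)
    x e * (ln (x e / outflow x i) - ln (p e)).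

Section Supported.
Variable x : link G -> R.
Hypotheses (xF : dest_feasible Q d x)
  (x_supp : forall e, 0 < x e -> 0 < alpha P e d).

Let x_ge0 e : 0 <= x e. Proof. by case: xF. Qed.

Let src_neq e : 0 < x e -> src e != d.
Proof.
by apply: contraTneq => /(dest_link_flow0 dD xF) ->; rewrite ltxx.
Qed.

Lemma supported_connected e : 0 < x e -> connected_to P d (tgt e).
Proof.
apply: positive_flow_connect dD _ xF _ _ e => e xe.
by apply/existsP; exists e; rewrite !eqxx x_supp.
Qed.

Lemma supported_src_connected e : 0 < x e -> connected_to P d (src e).
Proof.
by move=> xe; apply: connected_link (x_supp xe) (supported_connected xe).
Qed.

Lemma unconnected_outflow0 i : ~~ connected_to P d i -> outflow x i = 0.
Proof.
move=> ic; apply/eqP; rewrite eq_le (outflow_ge0 xF) andbT leNgt.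
apply: contra ic => /(outflow_gt0_link xF)[e <-].
exact: supported_src_connected.
Qed.

(** This is where solvability of the optimization problem restricts the data: a
flow of finite objective cannot serve a demand at an unconnected node. *)
Lemma unconnected_trips0 i : i != d -> ~~ connected_to P d i ->
  trips Q i d = 0.
Proof.
move=> id ic; apply/eqP; rewrite eq_le trips_ge0// andbT.
rewrite -(unconnected_outflow0 ic) (outflow_balance xF)// lerDl.
exact: sumr_ge0.
Qed.

(** Replace each link cost by its expression in [choice_prob_ln]: the potential
differences sum to the constant, and the [ln alpha] cancel. *)
Lemma fd_objectiveE :
  fd_objective P c d x = (expected_total_cost + divergence x)%:E.
Proof.
rewrite fd_objective_fin//; congr EFin.
have cE e : c e * x e =
    (theta P (src e) d)^-1 * (x e * (ln (alpha P e d) - ln (p e))) +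
    (V (src e) - V (tgt e)) * x e.
  have := x_ge0 e; rewrite le_eqVlt => /orP[/eqP<-|xe].
    by rewrite !(mulr0, mul0r) addr0.
  have [_ {1}->] := choice_prob_ln dD sP (src_neq xe) (x_supp xe)
    (supported_connected xe).
  by rewrite /=; ring.
have Vd : V d = 0 by case: sP => /= ->.
have pot : \sum_e (fine (s (src e) d) - fine (s (tgt e) d)) * x e =
  expected_total_cost := potential_flow xF Vd.
rewrite (eq_bigr _ (fun e _ => cE e)) big_split/= pot.
rewrite /divergence addrAC addrC; congr (_ + _).
rewrite (partition_big (@src G) xpredT)//= -big_split/=.
apply: eq_bigr => i _.
rewrite (eq_bigr (fun e => (theta P i d)^-1 *
    (x e * (ln (alpha P e d) - ln (p e))))); last by move=> e /eqP ->.
rewrite -mulr_sumr -mulrDr -big_split/=; congr (_ * _).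
by apply: eq_bigr => e _; ring.
Qed.

Let p_gt0 e : 0 < x e -> 0 < p e.
Proof.
move=> xe.
by case: (choice_prob_ln dD sP (src_neq xe) (x_supp xe) (supported_connected xe)).
Qed.

Let p_total i : (\sum_(e : link G | src e == i) p e) *
  (\sum_(e : link G | src e == i) x e) = \sum_(e : link G | src e == i) x e.
Proof.
have [->|id] := eqVneq i d; first by rewrite -/(outflow x d) (dest_outflow0 dD xF) mulr0.
have [ic|ic] := boolP (connected_to P d i).
  by rewrite choice_prob_sum1// mul1r.
by rewrite -/(outflow x i) unconnected_outflow0// mulr0.
Qed.

Let node_divergence_ge0 i : 0 <= (theta P i d)^-1 *
  \sum_(e : link G | src e == i) x e * (ln (x e / outflow x i) - ln (p e)).
Proof.
apply: mulr_ge0; first by rewrite invr_ge0 ltW// theta_gt0.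
apply: gibbs_ge0 => [//|e _|e _|]; last exact: p_total.
- exact: choice_prob_ge0.
- exact: p_gt0.
Qed.

Lemma divergence_ge0 : 0 <= divergence x.
Proof. exact: sumr_ge0. Qed.

Lemma divergence_eq0P : divergence x = 0 <->
  forall e, src e != d -> x e = p e * outflow x (src e).
Proof.
have gibbs i : \sum_(e : link G | src e == i)
      x e * (ln (x e / outflow x i) - ln (p e)) = 0 <->
    forall e, src e == i -> x e = p e * outflow x i.
  apply: gibbs_eq0P => [//|e' _|e' _|]; last exact: p_total.
  - exact: choice_prob_ge0.
  - exact: p_gt0.
split=> [/eqP|xE].
  rewrite psumr_eq0// => /allP div0 e ed.
  have := div0 (src e) (mem_index_enum _).
  rewrite mulf_eq0 invr_eq0 gt_eqF ?theta_gt0//= => /eqP.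
  by rewrite gibbs; apply.
apply: big1 => i _; rewrite (gibbs i).2 ?mulr0// => e /eqP <-.
have [ed|ed] := eqVneq (src e) d; last exact: xE.
by rewrite ed (dest_outflow0 dD xF) mulr0 (dest_link_flow0 dD xF).
Qed.

End Supported.

Lemma loading_supported x : is_loading x ->
  forall e, 0 < x e -> 0 < alpha P e d.
Proof.
move=> [xF xE] e xe; rewrite lt0r alpha_ge0// andbT.
apply: contraTneq xe => a0; have [ed|ed] := eqVneq (src e) d.
  by rewrite (dest_link_flow0 dD xF)// ltxx.
by rewrite xE// choice_prob_alpha0// mul0r ltxx.
Qed.

(** Loading goes from the origins towards [d], hence by recursion on
predecessors. *)
Let rev_rank (i : node G) := (#|node G| - reach_card i)%N.

Let rev_rank_lt e : (rev_rank (src e) < rev_rank (tgt e))%N.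
Proof.
apply: ltn_sub2l (reach_card_lt e).
exact: leq_trans (reach_card_lt e) (max_card _).
Qed.

Lemma loading_unique x y : is_loading x -> is_loading y -> x = y.
Proof.
move=> [xF xE] [yF yE].
suff outE i : outflow x i = outflow y i.
  apply/funext => e; have [ed|ed] := eqVneq (src e) d.
    by rewrite (dest_link_flow0 dD xF)// (dest_link_flow0 dD yF).
  by rewrite xE// yE// outE.
have [n] := ubnP (rev_rank i); elim: n => // n IHn in i * => le_n.
have [->|id] := eqVneq i d; first by rewrite (dest_outflow0 dD xF) (dest_outflow0 dD yF).
rewrite (outflow_balance xF)// (outflow_balance yF)//; congr (_ + _).
apply: eq_bigr => e /eqP ei; have [ed|ed] := eqVneq (src e) d.
  by rewrite (dest_link_flow0 dD xF)// (dest_link_flow0 dD yF).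
rewrite xE// yE// IHn//.
by apply: leq_trans (rev_rank_lt e) _; rewrite ei.
Qed.

(** Push the demand forward along the choice probabilities, dropping what
arrives at [d]. The flow so obtained is conserved where the probabilities sum
to 1; at an unconnected node they are 0, and conservation holds there because
neither demand nor flow arrives. *)
Lemma loading_exists :
  (forall i, i != d -> ~~ connected_to P d i -> trips Q i d = 0) ->
  exists x, is_loading x.
Proof.
move=> q0.
(* [Z] is the flow passing through a node, set to 0 at [d] so that no flow
   leaves [d]. *)
pose F (Z : node G -> R) i := if i == d then 0 else
  trips Q i d + \sum_(e : link G | tgt e == i) p e * Z (src e).
have [Z ZE] : exists Z, forall i, Z i = F Z i.
  apply: (rank_fixpoint (r := rev_rank) 0) => f g i fg.
  rewrite /F; case: ifP => // _; congr (_ + _).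
  by apply: eq_bigr => e /eqP ei; rewrite fg// -ei rev_rank_lt.
have Z_ge0 i : 0 <= Z i.
  have [n] := ubnP (rev_rank i); elim: n => // n IHn in i * => le_n.
  rewrite ZE /F; case: ifP => // _; rewrite addr_ge0 ?trips_ge0// sumr_ge0//.
  move=> e /eqP ei; rewrite mulr_ge0 ?choice_prob_ge0// IHn//.
  by apply: leq_trans (rev_rank_lt e) _; rewrite ei.
pose x e := p e * Z (src e).
have outE i : outflow x i = Z i.
  rewrite /outflow /x (eq_bigr (fun e => p e * Z i)); last by move=> e /eqP ->.
  rewrite -mulr_suml; have [->|id] := eqVneq i d.
    by rewrite ZE /F eqxx mulr0.
  have [ic|ic] := boolP (connected_to P d i).
    by rewrite choice_prob_sum1// mul1r.
  suff -> : Z i = 0 by rewrite mulr0.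
  rewrite ZE /F (negbTE id) q0// add0r big1// => e /eqP ei.
  by rewrite (choice_prob_unconnected dD sP) ?mul0r// ei.
exists x; split=> [|e _]; last by rewrite outE.
split=> [e|i id]; first by rewrite mulr_ge0// choice_prob_ge0.
by rewrite -/(outflow x i) outE ZE /F (negbTE id) addrK.
Qed.

(** Loadings attain the constant in [fd_objectiveE], which is a lower bound on
the objective. Conversely, a minimizer has a finite objective, so that a
loading exists, and comparison with it forces zero divergence. *)
Lemma minimizerP x : is_minimizer P c d x <-> is_loading x.
Proof.
have loading_value y : is_loading y ->
    fd_objective P c d y = expected_total_cost%:E.
  move=> yL; have [yF yE] := yL; have ys := loading_supported yL.
  by rewrite (fd_objectiveE yF ys) (divergence_eq0P yF ys).2// addr0.
split=> [[xF xfin xmin]|xL].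
  have xs := fd_objective_fin_num dD xF xfin.
  have [z zL] := loading_exists (unconnected_trips0 xF xs).
  split=> //; apply/(divergence_eq0P xF xs)/eqP.
  rewrite eq_le divergence_ge0// andbT.
  have := xmin z zL.1; rewrite (fd_objectiveE xF xs) loading_value// lee_fin.
  by rewrite gerDl.
have [xF _] := xL; split=> //; first by rewrite loading_value.
move=> y yF; rewrite (loading_value x)//.
have [ys|] := pselect (forall e, 0 < y e -> 0 < alpha P e d).
  by rewrite (fd_objectiveE yF ys) lee_fin lerDl divergence_ge0.
move=> /existsNP[e /not_implyP[ye ae]].
rewrite (fd_objective_pinfty c dD yF ye) ?leey//.
by apply/eqP; rewrite eq_le alpha_ge0// andbT leNgt; exact/negP.
Qed.

Lemma dest_demandP x : is_loading x ->
  dest_demand P c d = x /\ exists! y, is_minimizer P c d y.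
Proof.
move=> xL; have xm := (minimizerP x).2 xL.
split.
  apply: loading_unique xL; apply/minimizerP.
  by rewrite /dest_demand; exact: (xgetPex (fun=> 0) (ex_intro _ x xm)).
by exists x; split=> // y /minimizerP yL; exact: loading_unique.
Qed.

End Loading.

(** * The fixed-point problems *)

Section Equilibrium.
Variables (R : realType) (G : network) (K : costs R G) (Q : demand R G).
Variables (P : ngev_params Q) (c : link G -> R).

Lemma expected_min_costs_exist : exists s : node G -> node G -> \bar R,
  forall d, d \in dests Q -> expected_min_cost P c s d.
Proof.
have sol d : exists g : node G -> \bar R,
    d \in dests Q -> expected_min_cost P c (fun i _ => g i) d.
  have [dD|/negP dD] := boolP (d \in dests Q); last by exists (fun=> 0%E).
  by have [g gP] := expected_min_cost_exists P c dD; exists g.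
have [f fP] := choice sol.
by exists (fun i d => f d i).
Qed.

(** In an equilibrium the flow to each destination is a loading, hence the unique
minimizer. *)
Lemma ngev_equilibrium_demand xh s : is_ngev_equilibrium K P c xh s ->
  demand_defined P c /\ aggregate Q xh = demand_fun P c.
Proof.
move=> [xF _ _ sP xE].
have dem d (dD : d \in dests Q) : dest_demand P c d = xh d /\
    exists! y, is_minimizer P c d y.
  by apply: (dest_demandP dD (sP d dD)); split; [exact: xF | exact: xE].
split=> [d /dem[]//|]; apply/funext => e.
by apply: eq_bigr => d /dem[->].
Qed.

(** The expected minimum costs of [c] complete the minimizers to an equilibrium,
as soon as [c] is the cost of the resulting flow. *)
Lemma demand_ngev_equilibrium : demand_defined P c ->
  (forall e, link_costs K (demand_fun P c) e = (c e)%:E) ->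
  exists s, is_ngev_equilibrium K P c (dest_demand P c) s.
Proof.
move=> cdef costE; have [s sP] := expected_min_costs_exist.
have dL d : d \in dests Q -> is_loading P c d s (dest_demand P c d).
  move=> dD; apply/(minimizerP dD (sP d dD)).
  by have [x [xm _]] := cdef d dD; exact: (xgetPex (fun=> 0) (ex_intro _ x xm)).
have dF : hat_feasible Q (dest_demand P c) by move=> d /dL[].
exists s; split=> //; last by move=> d /dL[].
split; first by exists (dest_demand P c).
split=> e; last by rewrite costE.
by apply: sumr_ge0 => d /dF[].
Qed.

End Equilibrium.

Theorem corollary5p1 (R : realType) (G : network) (K : costs R G)
    (Q : demand R G) (P : ngev_params Q) :
  (forall x : link G -> R,
     (exists c xh s, is_ngev_equilibrium K P c xh s /\ x = aggregate Q xh)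
     <-> FP_A K P x) /\
  (forall c : link G -> R,
     (exists xh s, is_ngev_equilibrium K P c xh s) <-> FP_C K P c).
Proof.
split=> [x|c]; split.
- move=> [c [xh [s [eqP ->]]]]; have [cdef agg] := ngev_equilibrium_demand eqP.
  case: eqP => _ xY cE _ _; rewrite /FP_A.
  have -> : (fun e => fine (link_costs K (aggregate Q xh) e)) = c.
    by apply/funext => e; rewrite cE.
  by [].
- move=> [[xX [x0 xfin]] cdef xE].
  have [|s sP] := demand_ngev_equilibrium (K := K) cdef.
    by move=> e; rewrite -xE fineK.
  by eexists; eexists; exists s; split; [exact: sP | exact: xE].
- move=> [xh [s eqP]]; have [cdef agg] := ngev_equilibrium_demand eqP.
  case: eqP => _ [_ xY] cE _ _; split=> //.
    by exists (aggregate Q xh).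
  by move=> e; rewrite -agg cE.
- move=> [_ cdef cE].
  have [|s sP] := demand_ngev_equilibrium (K := K) cdef.
    by move=> e; rewrite cE.
  by exists (dest_demand P c), s.
Qed.
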